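(* Let $y_1,\ldots,y_n\in\mathbb{R}$ be arbitrary and let $k\ge0$ be an integer. The $k$th degree discrete spline interpolant $f\in\mathcal{H}^k_n=\mathrm{span}\{h^k_1,\ldots,h^k_n\}$ (with knots in $\{x_{k+1},\ldots,x_{n-1}\}$) satisfying $f(x_i)=y_i$, $i=1,\ldots,n$, can be constructed in the following manner. For $x\in[a,b]\setminus\{x_1,\ldots,x_n\}$: if $x>x_{k+1}$ and $i$ is the smallest index such that $x_i>x$ (with $i=n$ when $x>x_n$), then $f(x)$ is the unique solution of the linear system (in the one unknown $f(x)$) $$f[x_{i-k},\ldots,x_i,x]=0;$$ if instead $x<x_{k+1}$, then $f(x)$ is the unique solution of the linear system (in the one unknown $f(x)$) $$f[x_1,\ldots,x_{k+1},x]=0.$$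
   Context: Design points: $a\le x_1<\cdots<x_n\le b$ with $n\ge k+1$. Empty products equal 1. Divided differences: $f[z]=f(z)$ and $f[z_1,\ldots,z_{r+1}]=(f[z_2,\ldots,z_{r+1}]-f[z_1,\ldots,z_r])/(z_{r+1}-z_1)$ for distinct points (in any order). The values $f(x_1)=y_1,\ldots,f(x_n)=y_n$ are given, so each displayed equation is a linear equation in the single unknown $f(x)$. Falling factorial basis on $[a,b]$: $h^k_j(x)=\frac1{(j-1)!}\prod_{\ell=1}^{j-1}(x-x_\ell)$ for $j=1,\ldots,k+1$, and $h^k_j(x)=\frac1{k!}\prod_{\ell=j-k}^{j-1}(x-x_\ell)\cdot1\{x>x_{j-1}\}$ for $j=k+2,\ldots,n$. The space $\mathcal{H}^k_n$ is called the space of $k$th degree discrete splines with knots in $\{x_{k+1},\ldots,x_{n-1}\}$; each set of values $y_1,\ldots,y_n$ has exactly one interpolant in $\mathcal{H}^k_n$. *)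

(* Defs.v *)
From mathcomp Require Import all_boot all_order all_algebra.
From mathcomp Require Import reals.

Set Implicit Arguments.
Unset Strict Implicit.
Unset Printing Implicit Defensive.

Import Order.TTheory GRing.Theory Num.Theory.
Local Open Scope ring_scope.

(* Points x_1, ..., x_n and values y_1, ..., y_n are functions on nat of which
   only the arguments 1, ..., n matter.  Functions on [a, b] are functions on R
   of which only the restriction to [a, b] matters. *)

Definition design_points (R : realType) (a b : R) (n : nat) (x : nat -> R) : Prop :=
  [/\ a <= x 1%N, (forall i, (1 <= i < n)%N -> x i < x i.+1) & x n <= b].

(* h^k_j (t); the index j is meant in 1, ..., n. *)
Definition falling_basis (R : realType) (x : nat -> R) (k j : nat) (t : R) : R :=
  if (j <= k.+1)%N then (\prod_(1 <= l < j) (t - x l)) / (j.-1)`!%:R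
  else (\prod_(j - k <= l < j) (t - x l)) / k`!%:R * (if x j.-1 < t then 1 else 0).

Definition discrete_spline (R : realType) (a b : R) (x : nat -> R) (k n : nat)
    (f : R -> R) : Prop :=
  exists c : nat -> R, forall t, a <= t <= b ->
    f t = \sum_(1 <= j < n.+1) c j * falling_basis x k j t.

Definition spline_interpolant (R : realType) (a b : R) (x y : nat -> R) (k n : nat)
    (f : R -> R) : Prop :=
  discrete_spline a b x k n f /\ (forall i, (1 <= i <= n)%N -> f (x i) = y i).

(* f[z_s, ..., z_(s+r)] *)
Fixpoint divdiff_rec (R : realType) (f : R -> R) (z : nat -> R) (r s : nat) : R :=
  if r is r'.+1 then
    (divdiff_rec f z r' s.+1 - divdiff_rec f z r' s) / (z (s + r)%N - z s)
  else f (z s).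

(* Meaningful when zs is nonempty and duplicate-free. *)
Definition divdiff (R : realType) (f : R -> R) (zs : seq R) : R :=
  divdiff_rec f (nth 0 zs) (size zs).-1 0.

(* Relational form; the case t > x_n is the convention i = n. *)
Definition next_index (R : realType) (x : nat -> R) (n : nat) (t : R) (i : nat) : Prop :=
  [/\ (1 <= i <= n)%N, t < x i & forall l, (1 <= l <= n)%N -> t < x l -> (i <= l)%N]
  \/ (x n < t /\ i = n).

(* The equation f[x_p, ..., x_(p+k), t] = 0 in the unknown value v of f at t,
   the values of f at the other points being kept. *)
Definition local_equation (R : realType) (x : nat -> R) (k p : nat)
    (f : R -> R) (t v : R) : Prop :=
  divdiff [eta f with t |-> v] (rcons [seq x l | l <- iota p k.+1] t) = 0.

(* Main.v *)
Require Import Defs.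
From mathcomp Require Import all_boot all_order all_algebra.
From mathcomp Require Import reals.
From mathcomp Require Import zify ring.

Set Implicit Arguments.
Unset Strict Implicit.
Unset Printing Implicit Defensive.

Import Order.TTheory GRing.Theory Num.Theory.
Local Open Scope ring_scope.

(** The idea is that a discrete spline, seen only at the k + 1 design points of
    a window and at a point t adjacent to it, is a single polynomial of degree
    at most k.  Indeed let x_(m-k), ..., x_m be the window, with t beyond
    x_(m-1) when m > k + 1 and not beyond x_m when m < n.  The basis functions
    h_j with j <= m have their truncation active at t, and at a window point
    where it is inactive the factor product vanishes anyway; so these h_j may be
    replaced by their underlying polynomials.  The h_j with j > m all vanish on
    the window and at t.  This is [spline_window_poly].  The system for
    t > x_(k+1) is the case m = i, and the one for t < x_(k+1) is the case
    m = k + 1.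

    A divided difference on r + 1 distinct points is the coefficient of degree r of the
    interpolating polynomial, so it vanishes exactly when the values at these
    points come from a polynomial of degree less than r ([divdiff_eq0]).
    Both halves of the local claim follow ([local_equation_unique]): f(t) solves
    the equation because f is such a polynomial on the window and t, and any
    solution v makes the values on the window and t come from a polynomial of
    degree at most k, which the k + 1 window values determine, so that
    v = f(t).

    The interpolant exists and is unique because the matrix h_j(x_i) is
    lower triangular with nonzero diagonal. *)

(** * Divided differences and interpolating polynomials *)

Lemma poly_eq_on_points (F : idomainType) (p q : {poly F}) (s : seq F) :
  uniq s -> (size p <= size s)%N -> (size q <= size s)%N ->
  {in s, forall u, p.[u] = q.[u]} -> p = q.
Proof.
move=> us sp sq pq; apply/eqP; rewrite -subr_eq0; apply/eqP.
apply: (roots_geq_poly_eq0 (rs := s)) => //.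
  by apply/allP => u us'; rewrite rootE !hornerE (pq u us') subrr.
by rewrite (leq_trans (size_polyD _ _)) // size_polyN geq_max sp sq.
Qed.

(** This is Neville's scheme: if A and B interpolate f on the first and on the
    last r + 1 of the points z_s, ..., z_(s+r+1), then
    ((X - z_s) B - (X - z_(s+r+1)) A) / (z_(s+r+1) - z_s) interpolates f on all
    of them, and its top coefficient obeys the recursion that defines divided
    differences. *)
Lemma divdiff_rec_interpolation (R : realType) (f : R -> R) (z : nat -> R)
    (r s : nat) :
  (forall i j, (s <= i < j)%N -> (j <= s + r)%N -> z i != z j) ->
  exists P : {poly R}, [/\ (size P <= r.+1)%N,
    (forall i, (s <= i <= s + r)%N -> P.[z i] = f (z i)) &
    P`_r = divdiff_rec f z r s].
Proof.
elim: r s => [|r IH] s zinj.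
  exists (f (z s))%:P; split=> [|i|]; rewrite ?coefC ?size_polyC ?leq_b1 //.
  by rewrite addn0 -eqn_leq => /eqP <-; rewrite hornerC.
have [|A [sA hA cA]] := IH s; first by move=> i j *; apply: zinj; lia.
have [|B [sB hB cB]] := IH s.+1; first by move=> i j *; apply: zinj; lia.
set d := z (s + r.+1)%N - z s.
have d0 : d != 0 by rewrite subr_eq0 eq_sym; apply: zinj; lia.
exists (d^-1 *: (('X - (z s)%:P) * B - ('X - (z (s + r.+1)%N)%:P) * A)).
split=> [|i hi|].
- rewrite (leq_trans (size_scale_leq _ _)) //.
  rewrite (leq_trans (size_polyD _ _)) // size_polyN geq_max.
  by rewrite !(leq_trans (size_polyMleq _ _)) // size_XsubC /= ltnS.
- rewrite !hornerE; apply: (mulfI d0); rewrite mulVKf //.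
  have [->|i1] := eqVneq i s.
    by rewrite hA ?leqnn ?leq_addr // subrr mul0r sub0r -mulNr opprB.
  have [->|i2] := eqVneq i (s + r.+1)%N.
    by rewrite hB ?subrr ?mul0r ?subr0 //; lia.
  by rewrite hA ?hB /d; [ring|lia|lia].
- rewrite coefZ coefB !mulrBl !coefB !coefXM !coefCM /= cA cB.
  rewrite (nth_default 0 sA) (nth_default 0 sB) !mulr0 !subr0 -/d.
  by rewrite mulrC.
Qed.

(** The interpolating polynomial has degree below the maximum exactly when its
    top coefficient, the divided difference, is zero; and any polynomial of
    lower degree that takes the same values is the interpolating polynomial. *)
Lemma divdiff_eq0 (R : realType) (f : R -> R) (zs : seq R) :
  uniq zs -> (0 < size zs)%N ->
  divdiff f zs = 0 <->
  exists2 q : {poly R}, (size q < size zs)%N & {in zs, forall u, q.[u] = f u}.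
Proof.
move=> uz z0.
have [|P [sP hP cP]] := @divdiff_rec_interpolation R f (nth 0 zs) (size zs).-1 0.
  move=> i j /andP[_ ij] jz; have jn : (j < size zs)%N by rewrite -(prednK z0) ltnS.
  by rewrite nth_uniq ?(ltn_trans ij) // ltn_eqF.
rewrite prednK // in sP.
have hPz : {in zs, forall u, P.[u] = f u}.
  move=> u uzs; rewrite -(nth_index 0 uzs); apply: hP.
  by rewrite add0n -(ltnS (index _ _)) prednK // index_mem.
rewrite /divdiff -cP; split=> [c0|[q sq hq]].
  exists P => //; rewrite -(prednK z0) ltnS; apply/leq_sizeP => j.
  rewrite leq_eqVlt => /orP[/eqP <- //|hj].
  by apply: nth_default; apply: leq_trans sP _; rewrite -(prednK z0).
have -> : P = q.
  apply: (poly_eq_on_points uz) => //; first exact: ltnW.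
  by move=> u hu; rewrite hPz ?hq.
by apply: nth_default; rewrite -ltnS prednK.
Qed.

(** * Triangular systems *)

Lemma triangular_solvable (F : fieldType) (H : nat -> nat -> F) (y : nat -> F)
    (n : nat) :
  (forall i j, (0 < i < j)%N -> (j <= n)%N -> H i j = 0) ->
  (forall i, (0 < i <= n)%N -> H i i != 0) ->
  exists c : nat -> F, forall i, (0 < i <= n)%N ->
    \sum_(1 <= j < n.+1) c j * H i j = y i.
Proof.
elim: n => [|n IH] H0 Hd; first by exists (fun=> 0) => i; lia.
have [||c hc] := IH; [by move=> *; apply: H0; lia|by move=> *; apply: Hd; lia|].
pose S := \sum_(1 <= j < n.+1) c j * H n.+1 j.
exists [eta c with n.+1 |-> (y n.+1 - S) / H n.+1 n.+1] => i hi.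
rewrite big_nat_recr //= eqxx.
rewrite (eq_big_nat _ _ (F2 := fun j => c j * H i j)); last first.
  by move=> j hj; rewrite ifN //; apply/eqP; lia.
have [->|ni] := eqVneq i n.+1; first by rewrite divfK ?Hd ?leqnn // addrC subrK.
by rewrite hc ?(H0 i) ?mulr0 ?addr0 //; lia.
Qed.

Lemma triangular_injective (F : fieldType) (H : nat -> nat -> F)
    (c d : nat -> F) (n : nat) :
  (forall i j, (0 < i < j)%N -> (j <= n)%N -> H i j = 0) ->
  (forall i, (0 < i <= n)%N -> H i i != 0) ->
  (forall i, (0 < i <= n)%N ->
    \sum_(1 <= j < n.+1) c j * H i j = \sum_(1 <= j < n.+1) d j * H i j) ->
  forall i, (0 < i <= n)%N -> c i = d i.
Proof.
move=> H0 Hd cd; elim/ltn_ind => i IH hi.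
(* Row i involves only the unknowns up to i. *)
have head e : \sum_(1 <= j < n.+1) e j * H i j =
    \sum_(1 <= j < i) e j * H i j + e i * H i i.
  rewrite (@big_cat_nat _ _ _ i.+1) /=; [|lia|lia].
  rewrite [X in _ + X]big_nat_cond [X in _ + X]big1; last first.
    by move=> j hj; rewrite H0 ?mulr0 //; lia.
  by rewrite addr0 big_nat_recr //=; lia.
move: (cd i hi); rewrite !head.
rewrite (eq_big_nat _ _ (F2 := fun j => d j * H i j)); last first.
  by move=> j hj; rewrite IH //; lia.
by move=> /addrI /mulIf; apply; apply: Hd.
Qed.

(** * The falling factorial basis *)

(** The polynomial that coincides with [falling_basis x k j] where the
    truncation factor is 1. *)
Definition falling_poly (R : realType) (x : nat -> R) (k j : nat) : {poly R} :=
  if (j <= k.+1)%N then ((j.-1)`!%:R)^-1 *: \prod_(1 <= l < j) ('X - (x l)%:P)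
  else (k`!%:R)^-1 *: \prod_(j - k <= l < j) ('X - (x l)%:P).

Lemma size_falling_poly (R : realType) (x : nat -> R) (k j : nat) :
  (size (falling_poly x k j) <= k.+1)%N.
Proof.
rewrite /falling_poly; case: ifP => hj; rewrite (leq_trans (size_scale_leq _ _)) //;
by rewrite size_prod_XsubC size_iota; lia.
Qed.

Lemma falling_basisE (R : realType) (x : nat -> R) (k j : nat) (t : R) :
  falling_basis x k j t =
  if (j <= k.+1)%N || (x j.-1 < t) then (falling_poly x k j).[t] else 0.
Proof.
rewrite /falling_basis /falling_poly; case: ifP => hj /=.
  by rewrite hornerZ horner_prod mulrC; under [in RHS]eq_bigr do rewrite hornerXsubC.
case: ifP => _; rewrite ?mulr0 // mulr1 hornerZ horner_prod mulrC.
by under [in RHS]eq_bigr do rewrite hornerXsubC.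
Qed.

(** For j <= k the truncated difference j - k is 0 while the product starts at
    1, whence the hypothesis [0 < l]. *)
Lemma falling_poly_root (R : realType) (x : nat -> R) (k j l : nat) :
  (0 < l)%N -> (j - k <= l < j)%N -> (falling_poly x k j).[x l] = 0.
Proof.
move=> l0 hl; rewrite /falling_poly; case: ifP => _;
  rewrite hornerZ horner_prod (bigD1_seq l) ?iota_uniq ?mem_index_iota //=;
  by rewrite ?hornerXsubC ?subrr ?mul0r ?mulr0 //; lia.
Qed.

Lemma design_points_lt (R : realType) (a b : R) (n : nat) (x : nat -> R) i j :
  design_points a b n x -> (0 < i < j)%N -> (j <= n)%N -> x i < x j.
Proof.
move=> [_ hx _] /andP[i0]; elim: j => // j IH; rewrite ltnS leq_eqVlt.
move=> /orP[/eqP <-|ij] jn; first by apply: hx; rewrite i0.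
by apply: lt_trans (hx j _); [apply: IH => //; lia|lia].
Qed.

Lemma design_points_le (R : realType) (a b : R) (n : nat) (x : nat -> R) i j :
  design_points a b n x -> (0 < i <= j)%N -> (j <= n)%N -> x i <= x j.
Proof.
move=> hx /andP[i0]; rewrite leq_eqVlt => /orP[/eqP -> //|ij] jn.
by apply/ltW/(design_points_lt hx) => //; rewrite i0.
Qed.

Lemma design_points_itv (R : realType) (a b : R) (n : nat) (x : nat -> R) i :
  design_points a b n x -> (0 < i <= n)%N -> a <= x i <= b.
Proof.
move=> hx hi; have [ax _ xb] := hx; apply/andP; split.
  by apply: (le_trans ax); apply: (design_points_le hx); lia.
by apply: le_trans xb; apply: (design_points_le hx); lia.
Qed.

(** For j <= k + 1 the point x_i is a root of the product; for larger j it does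
    not exceed x_(j-1), so the truncation factor is 0. *)
Lemma falling_basis_upper (R : realType) (a b : R) (n k : nat) (x : nat -> R) i j :
  design_points a b n x -> (0 < i < j)%N -> (j <= n)%N ->
  falling_basis x k j (x i) = 0.
Proof.
move=> hx hij jn; rewrite falling_basisE.
have [jk|kj] := leqP j k.+1; first by rewrite falling_poly_root //; lia.
by rewrite /= ltNge (design_points_le hx) //; lia.
Qed.

Lemma falling_basis_diag (R : realType) (a b : R) (n k : nat) (x : nat -> R) j :
  design_points a b n x -> (0 < j <= n)%N -> falling_basis x k j (x j) != 0.
Proof.
move=> hx hj; rewrite falling_basisE ifT; last first.
  have [//|/= kj] := leqP j k.+1.
  by apply: (design_points_lt hx); lia.
rewrite /falling_poly; case: ifP => hk;
  rewrite hornerZ horner_prod mulf_neq0 ?invr_eq0 ?pnatr_eq0 -?lt0n ?fact_gt0 //;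
  rewrite big_seq prodf_seq_neq0; apply/allP => l; rewrite mem_index_iota => hl;
  by apply/implyP => _; rewrite hornerXsubC subr_eq0 gt_eqF // (design_points_lt hx) //; lia.
Qed.

(** * Splines on a window of design points *)

(** The polynomial q is the part of the spline carried by h_1, ..., h_m, without
    truncations.  When m = k + 1 no truncated function is involved, so t may lie
    anywhere to the left; when m = n none is left out, so t may lie anywhere to
    the right. *)
Lemma spline_window_poly (R : realType) (a b : R) (n k m : nat) (x c : nat -> R)
    (t : R) :
  design_points a b n x -> (k < m <= n)%N ->
  ((k.+1 < m)%N -> x m.-1 < t) -> ((m < n)%N -> t <= x m) ->
  exists2 q : {poly R}, (size q <= k.+1)%N &
    {in rcons [seq x l | l <- iota (m - k) k.+1] t, forall u,
      q.[u] = \sum_(1 <= j < n.+1) c j * falling_basis x k j u}.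
Proof.
move=> hx hm tl tr.
exists (\sum_(1 <= j < m.+1) c j *: falling_poly x k j).
  apply: (leq_trans (size_sum _ _ _)); apply/bigmax_leqP_seq => j _ _.
  exact: leq_trans (size_scale_leq _ _) (size_falling_poly _ _ _).
move=> u; rewrite mem_rcons inE => hu.
rewrite [RHS](@big_cat_nat _ _ _ m.+1) /=; [|lia|lia].
(* The h_j with j > m are truncated at x_(j-1) >= x_m, hence vanish. *)
rewrite [X in _ = _ + X]big_nat_cond [X in _ = _ + X]big1; last first.
  move=> j; rewrite andbT => hj; rewrite falling_basisE ifF ?mulr0 //.
  apply/negbTE; rewrite negb_or -ltnNge -leNgt; apply/andP; split; first by lia.
  case/predU1P: hu => [->|/mapP[l]].
    by apply: (le_trans (tr _)); [|apply: (design_points_le hx)]; lia.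
  by rewrite mem_iota => hl ->; apply: (design_points_le hx); lia.
rewrite addr0 horner_sum; apply: eq_big_nat => j hj.
rewrite hornerZ falling_basisE; congr (_ * _).
have [//|kj /=] := leqP j k.+1.
(* For k + 1 < j <= m: t lies beyond x_(j-1); a window point that does not is
   one of x_(j-k), ..., x_(j-1), all roots of the polynomial. *)
case/predU1P: hu => [->|/mapP[l]].
  rewrite ifT //; apply: le_lt_trans (tl _); last by lia.
  by apply: (design_points_le hx); lia.
rewrite mem_iota => hl ->; case: ifP => // /negbT; rewrite -leNgt => xle.
apply: falling_poly_root; first by lia.
apply/andP; split; first by lia.
rewrite ltnNge; apply/negP => jl.
by move: xle; rewrite leNgt (design_points_lt hx) //; lia.
Qed.

(** Moving the value v at t changes nothing on the k + 1 window points, which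
    already determine a polynomial of degree at most k; so only v = q(t) is
    compatible with a vanishing divided difference. *)
Lemma local_equation_unique (R : realType) (x : nat -> R) (k p : nat)
    (f : R -> R) (t : R) (q : {poly R}) :
  uniq (rcons [seq x l | l <- iota p k.+1] t) -> (size q <= k.+1)%N ->
  {in rcons [seq x l | l <- iota p k.+1] t, forall u, q.[u] = f u} ->
  unique (local_equation x k p f t) (f t).
Proof.
set zs := rcons _ t => uz sq hq.
have sz : size zs = k.+2 by rewrite size_rcons size_map size_iota.
have tz : t \in zs by rewrite mem_rcons mem_head.
have z0 : (0 < size zs)%N by rewrite sz.
have eq0P v := @divdiff_eq0 R [eta f with t |-> v] zs uz z0.
split.
  apply/eq0P; exists q; first by rewrite sz.
  by move=> u /hq -> /=; case: eqP => // ->.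
move=> v /eq0P[q' sq' hq'].
have qq : q = q'.
  move: uz; rewrite rcons_uniq => /andP[tn um].
  rewrite sz ltnS in sq'.
  apply: (poly_eq_on_points um); rewrite ?size_map ?size_iota //.
  move=> u hu; have uzs : u \in zs by rewrite mem_rcons inE hu orbT.
  by rewrite hq // hq' //= ifN //; apply: contraNneq tn => <-.
by rewrite -hq // qq hq' //= eqxx.
Qed.

Theorem corollary2 (R : realType) (k n : nat) (a b : R) (x y : nat -> R)
    (hkn : (k.+1 <= n)%N) (hx : design_points a b n x) :
  (exists2 f : R -> R, spline_interpolant a b x y k n f &
     forall g : R -> R, spline_interpolant a b x y k n g ->
       forall t, a <= t <= b -> g t = f t) /\
  (forall f : R -> R, spline_interpolant a b x y k n f ->
   forall t : R, a <= t <= b -> (forall l, (1 <= l <= n)%N -> t <> x l) ->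
     (x k.+1 < t -> forall i : nat, next_index x n t i ->
        unique (local_equation x k (i - k) f t) (f t)) /\
     (t < x k.+1 -> unique (local_equation x k 1 f t) (f t))).
Proof.
split.
  pose H i j := falling_basis x k j (x i).
  have H0 i j : (0 < i < j)%N -> (j <= n)%N -> H i j = 0.
    exact: falling_basis_upper hx.
  have Hd i : (0 < i <= n)%N -> H i i != 0 by exact: falling_basis_diag hx.
  have [c hc] := triangular_solvable y H0 Hd.
  exists (fun t => \sum_(1 <= j < n.+1) c j * falling_basis x k j t).
    by split; [exists c|].
  move=> g [[d hd] gy] t abt; rewrite hd //; apply: eq_big_nat => j hj.
  congr (_ * _); apply: (triangular_injective H0 Hd) => // i hi.
  by rewrite hc // -gy // hd //; apply: (design_points_itv hx).
move=> f [[c hc] _] t abt tx.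
have window m : (k < m <= n)%N -> ((k.+1 < m)%N -> x m.-1 < t) ->
    ((m < n)%N -> t <= x m) -> unique (local_equation x k (m - k) f t) (f t).
  move=> hm tl tr.
  have [q sq hq] := spline_window_poly c hx hm tl tr.
  apply: local_equation_unique sq _.
    rewrite rcons_uniq map_inj_in_uniq ?iota_uniq ?andbT.
      by apply/mapP => -[l]; rewrite mem_iota => hl; apply: tx; lia.
    have inj l l' : (m - k <= l < l')%N -> (l' < m - k + k.+1)%N -> x l != x l'.
      by move=> *; rewrite lt_eqF // (design_points_lt hx) //; lia.
    move=> l l'; rewrite !mem_iota => /andP[l1 l2] /andP[l1' l2'] xll.
    have [ll|ll|//] := ltngtP l l'.
      by have /eqP := inj l l' (introT andP (conj l1 ll)) l2'.
    by have /eqP := inj l' l (introT andP (conj l1' ll)) l2; rewrite xll.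
  move=> u hu; rewrite hq // hc //.
  move: hu; rewrite mem_rcons inE => /predU1P[-> //|/mapP[l]].
  by rewrite mem_iota => hl ->; apply: (design_points_itv hx); lia.
split=> [kt i hi|tk]; last first.
  by have := window k.+1; rewrite subSnn; apply=> //; [lia|rewrite ltnn|rewrite ltW].
case: hi => [[hi ti mini]|[nt ->]].
  have ki : (k.+1 < i)%N.
    rewrite ltnNge; apply/negP => ik.
    have := lt_trans kt ti; rewrite ltNge (design_points_le hx) //; lia.
  apply: window => [|_|_]; [lia| |exact: ltW].
  rewrite ltNge le_eqVlt negb_or; apply/andP; split.
    by apply/eqP/tx; lia.
  by apply/negP => /mini; lia.
apply: window => [|h|]; [lia| |by rewrite ltnn].
by apply: lt_trans nt; apply: (design_points_lt hx); lia.
Qed.
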